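(* Let $C$ be a cycle containing $n$ arcs $(i,C(i))$, $i=1,\dots,n$. Assume that each arc $(a,b)$ has been assigned a real value $d(a,b)$. If $$V=\sum_{i=1}^{n} d(i,C(i))<0,$$ then there exists at least one value $i'$ with $1\le i'\le n$ such that $$\sum_{j=0}^{m} d\bigl(i'+j,\,C(i'+j)\bigr)<0\qquad\text{for all } m=0,1,\dots,n-1,$$ where $i'+j$ is represented by its value modulo $n$.
   Context: $C$ is a cyclic permutation of $\{1,\dots,n\}$, and its arcs are the pairs $(i,C(i))$. Indices are read modulo $n$ with representatives $1,\dots,n$. *)

(* Defs.v *)
From HB Require Import structures.
From mathcomp Require Import all_boot all_order all_algebra all_fingroup.
From mathcomp Require Import all_classical all_reals.

Set Implicit Arguments.
Unset Strict Implicit.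
Unset Printing Implicit Defensive.

Import Order.TTheory GRing.Theory Num.Theory.

(* The vertices 1, ..., n are the elements of 'I_n, vertex k being the ordinal
   of value k mod n, so that vertex n is the ordinal of value 0. *)

(* C is a single cycle through all n vertices; for n = 1 it is a loop. *)
Definition cyclic_perm (n : nat) (C : 'S_n) : Prop :=
  forall i : 'I_n, porbit C i = [set: 'I_n]%SET.

Lemma shift_label_subproof (n : nat) (i : 'I_n) (j : nat) : (i + j) %% n < n.
Proof. by rewrite ltn_pmod // (leq_ltn_trans _ (ltn_ord i)). Qed.

(* Addition of labels modulo n; it does not depend on the cycle C. *)
Definition shift_label (n : nat) (i : 'I_n) (j : nat) : 'I_n :=
  Ordinal (shift_label_subproof i j).

(* Main.v *)
(** Extend the arc values periodically to all natural numbers and let S(k) be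
    the sum of the first k of them, so that S(k + n) = S(k) + V. Start at the
    last maximizer i of S on [0, n): a window ending before n has negative sum
    because i is the last maximizer, and one reaching n or beyond has sum at
    most V because S(i) is the maximum. *)

Require Import Defs.
From HB Require Import structures.
From mathcomp Require Import all_boot all_order all_algebra all_fingroup.
From mathcomp Require Import all_classical all_reals.

Set Implicit Arguments.
Unset Strict Implicit.
Unset Printing Implicit Defensive.

Import Order.TTheory GRing.Theory Num.Theory.

Local Open Scope ring_scope.

(** Two nested maximizations: first of the value of [S], then of the index among those attaining
    that value. *)
Lemma last_maximizer (R : realDomainType) (n : nat) (S : nat -> R) :
  (0 < n)%N ->
  exists2 i : 'I_n, forall k, (k < n)%N -> S k <= S i
                  & forall k, (i < k < n)%N -> S k < S i.
Proof.
case: n => [//|n] _.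
case: (@Order.TotalTheory.arg_maxP _ _ _ (@ord0 n) predT (fun i => S i)) => // a _ Ha.
case: (@arg_maxnP _ a (fun i : 'I_n.+1 => S i == S a) (@nat_of_ord _)) => //.
move=> i /eqP Hi Hlast.
have Hmax k : (k < n.+1)%N -> S k <= S i.
  by move=> kn; rewrite Hi; have := Ha (Ordinal kn) isT.
exists i => // k /andP[ik kn]; rewrite lt_neqAle Hmax // andbT Hi.
by apply: contraL ik => Sk; rewrite -leqNgt; apply: (Hlast (Ordinal kn)).
Qed.

Lemma periodic_cycle_lemma (R : realDomainType) (n : nat) (g : nat -> R) :
  (0 < n)%N -> (forall k, g (n + k)%N = g k) -> \sum_(0 <= j < n) g j < 0 ->
  exists i : 'I_n, forall m, (m < n)%N -> \sum_(0 <= j < m.+1) g (i + j)%N < 0.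
Proof.
move=> n_gt0 gn V_lt0; pose S k := \sum_(0 <= j < k) g j.
have SD a b : S (a + b)%N = S a + \sum_(0 <= j < b) g (a + j)%N.
  rewrite /S (@big_cat_nat _ _ _ a) ?leq_addr //=; congr (_ + _).
  rewrite -{1}[a]add0n big_addn addKn.
  by apply: eq_bigr => j _; rewrite addnC.
have Sn k : S (n + k)%N = S n + S k.
  by rewrite SD; congr (_ + _); apply: eq_bigr => j _; exact: gn.
have [i Smax Slast] := last_maximizer S n_gt0.
(* Adding [S i] to both sides turns the claim into [S (i + m.+1) < S i]. *)
exists i => m mn; rewrite -(ltrD2l (S i)) -SD addr0.
have [lt_n|ge_n] := ltnP (i + m.+1) n.
  by apply: Slast; rewrite lt_n andbT addnS ltnS leq_addr.
(* Write [i + m.+1] as [n + r]: then [S n < 0] and [S r <= S i], where [r < n] because [i < n] and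
   [m < n]. *)
rewrite -(subnKC ge_n) Sn -[ltRHS]add0r ltr_leD //.
by apply: Smax; rewrite ltn_subLR // -addSn leq_add.
Qed.

Theorem theorem3p1 (R : realType) (n : nat) (C : 'S_n)
    (hC : cyclic_perm C) (d : 'I_n -> 'I_n -> R)
    (hV : \sum_(i < n) d i (C i) < 0) :
  exists i' : 'I_n, forall m : nat, (m < n)%N ->
    \sum_(0 <= j < m.+1) d (shift_label i' j) (C (shift_label i' j)) < 0.
Proof.
case: n C hC d hV => [|n] C _ d hV; first by rewrite big_ord0 ltxx in hV.
(* [g] lists the arc values from the ordinal 0 on, with indices reduced modulo [n.+1], which makes
   it periodic. *)
pose f i := d i (C i); pose g k := f (shift_label (@ord0 n) k).
have gE (i : 'I_n.+1) j : g (i + j)%N = f (shift_label i j).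
  by congr f; apply: val_inj.
have [||i Hi] := @periodic_cycle_lemma _ n.+1 g isT.
- by move=> k; congr f; apply: val_inj; rewrite /= !add0n modnDl.
- rewrite big_mkord (eq_bigr f) // => i _.
  by congr f; apply: val_inj; rewrite /= add0n modn_small.
by exists i => m /Hi; under eq_bigr do rewrite gE.
Qed.
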